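(* Let $A_1,\ldots,A_m,B_1,\ldots,B_m\in\mathbb{P}_n$ and let $\Phi:\mathbb{M}_n\to\mathbb{M}_d$ be a positive linear map. Then for every symmetric norm $\|\cdot\|$ on $\mathbb{M}_d$ and every non-decreasing geometrically convex function $g$, the map $$(t_1,\ldots,t_m)\mapsto \Big\| g\Big(\Phi\Big(\sum_{i=1}^m A_i\#_{t_i}B_i\Big)\Big)\Big\|$$ is jointly log-convex on $\mathbb{R}^m$.
   Context: $\mathbb{M}_n$ denotes the space of $n\times n$ complex matrices, $\mathbb{M}_n^+$ its positive semidefinite cone and $\mathbb{P}_n$ its positive definite cone. For $A,B\in\mathbb{P}_n$ and $t\in\mathbb{R}$, the weighted geometric mean is $A\#_tB=A^{1/2}(A^{-1/2}BA^{-1/2})^tA^{1/2}$ (this parametrizes the geodesic through $A$ and $B$ in the Riemannian manifold $\mathbb{P}_n$). A linear map $\Phi:\mathbb{M}_n\to\mathbb{M}_d$ is positive if $\Phi(\mathbb{M}_n^+)\subset\mathbb{M}_d^+$. A symmetric norm on $\mathbb{M}_d$ is a norm satisfying $\|UAV\|=\|A\|$ for all $A\in\mathbb{M}_d$ and all unitary $U,V$. A function $g:[0,\infty)\to[0,\infty)$ is geometrically convex if it is continuous, non-negative, and $g(\sqrt{ab})\le\sqrt{g(a)g(b)}$ for all $a,b>0$; $g$ is applied to positive semidefinite matrices by functional calculus. A function $F:\mathbb{R}^m\to[0,\infty)$ is jointly log-convex if $F((x+y)/2)\le\sqrt{F(x)F(y)}$ for all $x,y\in\mathbb{R}^m$.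 *)

(* Defs.v *)
From Stdlib Require Import Reals ClassicalEpsilon.
From mathcomp Require Import all_boot.
Set Implicit Arguments. Unset Strict Implicit. Unset Printing Implicit Defensive.
Open Scope R_scope.

Record C := mkC { Cre : R ; Cim : R }.
Definition C0 : C := mkC 0 0.
Definition C1 : C := mkC 1 0.
Definition RtoC (r : R) : C := mkC r 0.
Definition Cadd (x y : C) : C := mkC (Cre x + Cre y) (Cim x + Cim y).
Definition Cmul (x y : C) : C :=
  mkC (Cre x * Cre y - Cim x * Cim y) (Cre x * Cim y + Cim x * Cre y).
Definition Cconj (x : C) : C := mkC (Cre x) (- Cim x).
Definition Cmod (x : C) : R := sqrt (Cre x * Cre x + Cim x * Cim x).

Definition Mat (n : nat) := 'I_n -> 'I_n -> C.
Definition Vec (n : nat) := 'I_n -> C.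

Definition Csum (k : nat) (f : 'I_k -> C) : C := \big[Cadd/C0]_(i < k) f i.

Definition mzero (n : nat) : Mat n := fun _ _ => C0.
Definition mid (n : nat) : Mat n := fun i j => if i == j then C1 else C0.
Definition madd (n : nat) (A B : Mat n) : Mat n := fun i j => Cadd (A i j) (B i j).
Definition mscale (n : nat) (c : C) (A : Mat n) : Mat n := fun i j => Cmul c (A i j).
Definition mmul (n : nat) (A B : Mat n) : Mat n :=
  fun i j => Csum (fun k => Cmul (A i k) (B k j)).
Definition madj (n : nat) (A : Mat n) : Mat n := fun i j => Cconj (A j i).
Definition mdiag (n : nat) (lam : 'I_n -> R) : Mat n :=
  fun i j => if i == j then RtoC (lam i) else C0.
Definition msum (n m : nat) (F : 'I_m -> Mat n) : Mat n :=
  fun i j => Csum (fun k => F k i j).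

Definition qform (n : nat) (A : Mat n) (x : Vec n) : C :=
  Csum (fun i => Csum (fun j => Cmul (Cconj (x i)) (Cmul (A i j) (x j)))).

Definition hermitian (n : nat) (A : Mat n) : Prop := forall i j, A j i = Cconj (A i j).
Definition psd (n : nat) (A : Mat n) : Prop :=
  hermitian A /\ forall x : Vec n, 0 <= Cre (qform A x).
Definition pd (n : nat) (A : Mat n) : Prop :=
  hermitian A /\ forall x : Vec n, (exists i, x i <> C0) -> 0 < Cre (qform A x).

Definition unitary (n : nat) (U : Mat n) : Prop := mmul (madj U) U = @mid n.

Definition spectral_decomp (n : nat) (A U : Mat n) (lam : 'I_n -> R) : Prop :=
  unitary U /\ A = mmul (mmul U (mdiag lam)) (madj U).

(** functional calculus f(A) = U diag(f(lam)) U^* for Hermitian A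
    (chosen by Hilbert's epsilon; independent of the decomposition). *)
Definition funcalc (n : nat) (f : R -> R) (A : Mat n) : Mat n :=
  epsilon (inhabits (@mzero n))
    (fun B => exists U lam, spectral_decomp A U lam /\
       B = mmul (mmul U (mdiag (fun i => f (lam i)))) (madj U)).

Definition mpow (n : nat) (t : R) (A : Mat n) : Mat n :=
  funcalc (fun x => Rpower x t) A.

Definition gmean (n : nat) (t : R) (A B : Mat n) : Mat n :=
  let Ah := mpow (1/2) A in
  let Aih := mpow (- (1/2)) A in
  mmul (mmul Ah (mpow t (mmul (mmul Aih B) Aih))) Ah.

Definition positive_linear_map (n d : nat) (Phi : Mat n -> Mat d) : Prop :=
  (forall A B, Phi (madd A B) = madd (Phi A) (Phi B)) /\
  (forall c A, Phi (mscale c A) = mscale c (Phi A)) /\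
  (forall A, psd A -> psd (Phi A)).

Definition symmetric_norm (d : nat) (N : Mat d -> R) : Prop :=
  (forall A, 0 <= N A) /\
  (forall A, N A = 0 -> A = @mzero d) /\
  (forall c A, N (mscale c A) = Cmod c * N A) /\
  (forall A B, N (madd A B) <= N A + N B) /\
  (forall U V A, unitary U -> unitary V -> N (mmul (mmul U A) V) = N A).

(** g : [0,oo) -> [0,oo) continuous, geometrically convex
    (values of g on negative reals are irrelevant) *)
Definition continuous_on_nonneg (g : R -> R) : Prop :=
  forall x, 0 <= x -> forall eps, 0 < eps -> exists delta, 0 < delta /\
    forall y, 0 <= y -> Rabs (y - x) < delta -> Rabs (g y - g x) < eps.

Definition geom_convex (g : R -> R) : Prop :=
  continuous_on_nonneg g /\
  (forall x, 0 <= x -> 0 <= g x) /\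
  (forall a b, 0 < a -> 0 < b -> g (sqrt (a * b)) <= sqrt (g a * g b)).

Definition nondecreasing_nonneg (g : R -> R) : Prop :=
  forall x y, 0 <= x -> x <= y -> g x <= g y.

Definition jointly_log_convex (m : nat) (F : ('I_m -> R) -> R) : Prop :=
  (forall x, 0 <= F x) /\
  forall x y, F (fun i => (x i + y i) / 2) <= sqrt (F x * F y).

(* Main.v *)
(** Diagonalizing [A_i^(-1/2) B_i A_i^(-1/2)] writes [A_i #_t B_i] as
    [\sum_k c_k^t Q_k] with positive semidefinite [Q_k] independent of [t], so
    [Phi (\sum_i A_i #_{t_i} B_i) = V diag(w(t)) V^H] for a fixed matrix [V] and
    weights [w(t)] with [w((s+t)/2)^2 = w(s) w(t)].

    By Cauchy-Binet, [det (H V diag(w) V^H H^H)] is a combination of monomials in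
    [w] with nonnegative coefficients, so Cauchy-Schwarz makes it log-convex in
    [t].  Taking for the rows of [H] the top [k] eigenvectors at the midpoint gives
    [(\prod_(i<k) m_i)^2 <= \prod_(i<k) x_i y_i], where [m], [x], [y] are the
    decreasing eigenvalues at [(s+t)/2], [s], [t].

    The vector [m] is then obtained from [z_i = sqrt (x_i y_i)] by replacing pairs
    [(a, b)] by [(a/c, c b)] and by decreasing entries; since [g] is non-decreasing
    and [u |-> g (exp u)] is convex, neither step increases the gauge function
    [N (diag (g ...))].  Finally [g (z_i) <= (e g(x_i) + g(y_i)/e) / 2] for every
    [e > 0], and one optimizes in [e]. *)

Require Import Defs.
From Stdlib Require Import Reals Lra FunctionalExtensionality ClassicalEpsilon.
From mathcomp Require Import all_boot.
Set Implicit Arguments. Unset Strict Implicit. Unset Printing Implicit Defensive.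
Open Scope R_scope.

(** * Geometric convexity *)

(* The difference with the chord is at most half its own maximum on [0, 1]:
   a maximum point is the midpoint of an end point and another point. *)
Lemma midpoint_convex_chord (phi : R -> R) :
  continuity phi -> (forall x y, phi ((x + y) / 2) <= (phi x + phi y) / 2) ->
  forall s, 0 <= s <= 1 -> phi s <= (1 - s) * phi 0 + s * phi 1.
Proof.
move=> phi_cont phi_mid.
pose psi s := phi s - ((1 - s) * phi 0 + s * phi 1).
have psi_mid x y : psi ((x + y) / 2) <= (psi x + psi y) / 2.
  by rewrite /psi; have := phi_mid x y; lra.
have psi_cont : continuity psi.
  apply: continuity_minus => //; apply: derivable_continuous; reg.
have psi0 : psi 0 = 0 by rewrite /psi; lra.
have psi1 : psi 1 = 0 by rewrite /psi; lra.
have [M [Mmax M01]] := continuity_ab_maj psi 0 1 Rle_0_1 (fun c _ => psi_cont c).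
have psiM : psi M <= 0.
  case: (Rle_dec M (1 / 2)) => [Mle|Mgt].
    have := psi_mid 0 (2 * M); have := Mmax (2 * M) ltac:(lra).
    by rewrite psi0 (_ : (0 + 2 * M) / 2 = M); lra.
  have := psi_mid 1 (2 * M - 1); have := Mmax (2 * M - 1) ltac:(lra).
  by rewrite psi1 (_ : (1 + (2 * M - 1)) / 2 = M); lra.
move=> s s01; suff : psi s <= 0. rewrite /psi. lra.
exact: Rle_trans (Mmax s s01) psiM.
Qed.

Lemma sqrt_mul_le_mean (x y : R) : 0 <= x -> 0 <= y -> sqrt (x * y) <= (x + y) / 2.
Proof.
move=> x0 y0; rewrite -(sqrt_Rsqr ((x + y) / 2)); last lra.
by apply: sqrt_le_1_alt; have := Rle_0_sqr (x - y); rewrite /Rsqr; lra.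
Qed.

Lemma ln_le (x y : R) : 0 < x -> x <= y -> ln x <= ln y.
Proof.
move=> x0 /Rle_lt_or_eq_dec[xy|->]; last exact: Rle_refl.
exact/Rlt_le/ln_increasing.
Qed.

(* Convexity of [s |-> g (b * exp s)]. *)
Lemma geom_convex_transfer (g : R -> R) (a b c : R) :
  geom_convex g -> 0 < b -> 1 <= c -> c * b <= a ->
  exists theta, 0 <= theta <= 1 /\
    g (a / c) <= theta * g a + (1 - theta) * g b /\
    g (c * b) <= (1 - theta) * g a + theta * g b.
Proof.
move=> [g_cont [g_ge0 g_mid]] b0 c1 ca.
have bca : b <= c * b by nra.
(* On the scale [b * exp (s * T)] the parameters 0 and 1 stand for [b] and [a], and multiplying by
   [c] becomes a shift of [s]. *)
pose T := ln (a / b).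
have ab1 : c <= a / b.
  by apply: (Rmult_le_reg_r b) => //; rewrite /Rdiv Rmult_assoc Rinv_l; lra.
have expT : exp T = a / b by rewrite /T exp_ln; lra.
have lnc : exp (ln c) = c by rewrite exp_ln; lra.
have lnc0 : 0 <= ln c by rewrite -ln_1; apply: ln_le; lra.
have lncT : ln c <= T by apply: ln_le; lra.
pose phi s := g (b * exp (s * T)).
have e_gt0 s : 0 < b * exp (s * T).
  by apply: Rmult_lt_0_compat => //; apply: exp_pos.
have phi_cont : continuity phi.
  move=> s eps eps0.
  have [delta [delta0 gP]] := g_cont (b * exp (s * T)) (Rlt_le _ _ (e_gt0 s)) eps eps0.
  have arg_cont : continuity (fun s => b * exp (s * T)).
    by apply: derivable_continuous; reg.
  have [alp [alp0 aP]] := arg_cont s delta delta0.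
  exists alp; split=> // t tP; apply: gP; last exact: aP.
  exact/Rlt_le/e_gt0.
have phi_mid x y : phi ((x + y) / 2) <= (phi x + phi y) / 2.
  apply: Rle_trans (sqrt_mul_le_mean (g_ge0 _ (Rlt_le _ _ (e_gt0 x))) (g_ge0 _ (Rlt_le _ _ (e_gt0 y)))).
  apply: Rle_trans (g_mid _ _ (e_gt0 x) (e_gt0 y)).
  apply: Req_le; rewrite /phi; congr g; symmetry.
  set w := (x + y) / 2.
  rewrite (_ : _ * _ = Rsqr (b * exp (w * T))); first exact/sqrt_Rsqr/Rlt_le/e_gt0.
  have -> : exp (x * T) = exp (w * T) * exp ((x - y) / 2 * T).
    by rewrite -exp_plus; congr exp; rewrite /w; field.
  have -> : exp (y * T) = exp (w * T) * exp (- ((x - y) / 2 * T)).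
    by rewrite -exp_plus; congr exp; rewrite /w; field.
  rewrite exp_Ropp /Rsqr; field; exact/Rgt_not_eq/exp_pos.
have chord := midpoint_convex_chord phi_cont phi_mid.
have phi0 : phi 0 = g b by rewrite /phi Rmult_0_l exp_0 Rmult_1_r.
have phi1 : phi 1 = g a by rewrite /phi Rmult_1_l expT; congr g; field; lra.
(* If [T = 0], then [0 <= ln c <= T] forces [ln c = 0], and [s = 0] serves. *)
have [s [s01 sT]] : exists s, 0 <= s <= 1 /\ s * T = ln c.
  case: (Rle_lt_or_eq_dec 0 T) => [|T0|T0]; first lra.
    exists (ln c / T); split; last by field; lra.
    split; first by apply: Rmult_le_pos => //; apply/Rlt_le/Rinv_0_lt_compat.
    by apply: (Rmult_le_reg_r T) => //; rewrite /Rdiv Rmult_assoc Rinv_l; lra.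
  by exists 0; split; lra.
(* The points [c * b] and [a / c] sit at the mirror parameters [s] and [1 - s], so their chord
   bounds have swapped weights. *)
exists (1 - s); split; first lra.
have -> : a / c = b * exp ((1 - s) * T).
  rewrite Rmult_minus_distr_r sT Rmult_1_l /Rminus exp_plus exp_Ropp lnc expT.
  by field; lra.
have -> : c * b = b * exp (s * T) by rewrite sT lnc; ring.
rewrite -/(phi s) -/(phi (1 - s)) -phi0 -phi1.
by have := chord s s01; have := chord (1 - s) ltac:(lra); lra.
Qed.

(** Only zero arguments are new: there the left side is [g 0], whose square is at most [g x * g y]
    by monotonicity. *)
Lemma geom_convex_sqrt (g : R -> R) (x y : R) :
  geom_convex g -> nondecreasing_nonneg g -> 0 <= x -> 0 <= y ->
  g (sqrt (x * y)) <= sqrt (g x * g y).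
Proof.
move=> [g_cont [g_ge0 g_mid]] g_mono x0 y0.
have [x_gt|xE] := Rle_lt_or_eq_dec 0 x x0; last first.
  rewrite -xE Rmult_0_l sqrt_0 -[X in X <= _]sqrt_Rsqr; last by apply: g_ge0; lra.
  apply: sqrt_le_1_alt; rewrite /Rsqr.
  by apply: Rmult_le_compat_l; [apply: g_ge0; lra|apply: g_mono; lra].
have [y_gt|yE] := Rle_lt_or_eq_dec 0 y y0; last first.
  rewrite -yE Rmult_0_r sqrt_0 -[X in X <= _]sqrt_Rsqr; last by apply: g_ge0; lra.
  apply: sqrt_le_1_alt; rewrite /Rsqr.
  by apply: Rmult_le_compat_r; [apply: g_ge0; lra|apply: g_mono; lra].
exact: g_mid.
Qed.

(** The square root is the infimum of the weighted means. For [a > 0] the choice [c = p / a] gives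
    [p <= (p + a * b / p) / 2], hence [p * p <= a * b]. *)
Lemma le_sqrt_of_scaled_means (p a b : R) : 0 <= a -> 0 <= b ->
  (forall c, 0 < c -> p <= (c * a + / c * b) / 2) -> p <= sqrt (a * b).
Proof.
move=> a0 b0 H.
have [p0|p0] := Rle_dec p 0; first exact: Rle_trans (sqrt_pos _).
have {}p0 : 0 < p by lra.
have a_gt : 0 < a.
  apply: Rnot_le_lt => a_le.
  (* With [a = 0] this value of [c] yields [p <= p * (b / (b + 1)) / 2], impossible for [p > 0]. *)
  have c0 : 0 < (b + 1) / p by apply: Rdiv_lt_0_compat; lra.
  have := H _ c0; have -> : a = 0 by lra.
  have -> : (b + 1) / p * 0 + / ((b + 1) / p) * b = p * (b / (b + 1)) by field; lra.
  have : b / (b + 1) <= 1.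
    by apply: (Rmult_le_reg_r (b + 1)); [lra|rewrite /Rdiv Rmult_assoc Rinv_l; lra].
  nra.
have pa0 : 0 < p / a by apply: Rdiv_lt_0_compat.
have := H _ pa0.
have -> : p / a * a + / (p / a) * b = p + a * b / p by field; lra.
move=> Hp; have ppab : p * p <= a * b.
  apply: (Rmult_le_reg_r (/ p)); first exact: Rinv_0_lt_compat.
  by rewrite Rmult_assoc Rinv_r; [rewrite /Rdiv in Hp; lra|lra].
by rewrite -(sqrt_Rsqr p); [apply: sqrt_le_1_alt|lra].
Qed.

From mathcomp Require Import all_order all_algebra all_fingroup.
From mathcomp Require Import sesquilinear spectral complex Rstruct.
From mathcomp Require Import ring.
Import Order.TTheory GRing.Theory Num.Theory.
Local Close Scope R_scope.
Local Open Scope ring_scope.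

(** * Determinants and products of eigenvalues *)

(** Multilinearity in the rows: row [i] of the product is a combination of rows of [B], and [f i]
    records the row picked. *)
Lemma det_mulmx_expand (K : comNzRingType) k p (A : 'M[K]_(k, p)) (B : 'M[K]_(p, k)) :
  \det (A *m B) =
  \sum_(f : {ffun 'I_k -> 'I_p}) (\prod_i A i (f i)) * \det (rowsub f B).
Proof.
rewrite /determinant.
under eq_bigr => s _.
  under eq_bigr => i _ do rewrite mxE.
  rewrite bigA_distr_bigA mulr_sumr /=.
  over.
rewrite exchange_big /=; apply: eq_bigr => f _.
rewrite mulr_sumr; apply: eq_bigr => s _.
rewrite big_split /= mulrCA; congr (_ * (_ * _)).
by apply: eq_bigr => i _; rewrite mxE.
Qed.

(* Summing over all functions instead of increasing ones counts each minor [k!]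
   times. *)
Lemma cauchy_binet (K : comNzRingType) k p (A : 'M[K]_(k, p)) (B : 'M[K]_(p, k)) :
  \det (A *m B) *+ k`! =
  \sum_(f : {ffun 'I_k -> 'I_p}) \det (colsub f A) * \det (rowsub f B).
Proof.
transitivity (\sum_(s : {perm 'I_k}) \det (A *m B)).
  by rewrite sumr_const card_Sn.
symmetry; under eq_bigr => f _ do rewrite {1}/determinant mulr_suml.
rewrite exchange_big /=; apply: eq_bigr => s _.
(* Precomposing [f] with the inverse of [s] removes [s] from the product of entries of [A] and
   permutes the rows in the minor of [B]; the resulting sign cancels the sign of [s] in the Leibniz
   formula. *)
pose h (f : {ffun 'I_k -> 'I_p}) := [ffun i => f ((s^-1)%g i)].
rewrite det_mulmx_expand; rewrite (reindex_onto h (fun f => [ffun i => f (s i)])) /=; last first.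
  by move=> f _; apply/ffunP => i; rewrite !ffunE permKV.
apply: eq_big => [f|f _].
  by apply/eqP/ffunP => i; rewrite !ffunE permK.
have -> : rowsub (h f) B = row_perm (s^-1)%g (rowsub f B).
  by apply/matrixP => i j; rewrite !mxE ffunE.
rewrite row_permE det_mulmx det_perm odd_permV.
rewrite mulrCA !mulrA -[(-1) ^+ s * (-1) ^+ s]expr2 sqrr_sign mul1r; congr (_ * _).
by apply: eq_bigr => i _; rewrite mxE ffunE permK.
Qed.

Local Open Scope complex_scope.
Local Notation "A ^H" := (map_mx (@conjc _) A^T) (at level 8, format "A ^H").

(** Cauchy-Binet, with [w f] the squared modulus of the minor of [Z] on the columns [f], divided by
    the factorial of [k]. A repeated column makes the minor vanish, so only injective [f] count. *)
Lemma det_gram_expand (R : rcfType) k p (Z : 'M[R[i]]_(k, p)) :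
  exists2 w : {ffun 'I_k -> 'I_p} -> R,
    forall f, 0 <= w f /\ (w f != 0 -> injective f)
  & forall t : 'I_p -> R,
    \det (Z *m diag_mx (\row_j (t j)%:C) *m Z ^H) =
    (\sum_f w f * \prod_i t (f i))%:C.
Proof.
pose q (z : R[i]) : R := complex.Re z ^+ 2 + complex.Im z ^+ 2.
have qE z : z * conjc z = (q z)%:C.
  case: z => a b; rewrite /q /=; apply/eqP; rewrite eq_complex /=.
  by apply/andP; split; apply/eqP; ring.
have kP : (k`!%:R : R) != 0 by rewrite pnatr_eq0 -lt0n fact_gt0.
exists (fun f => q (\det (colsub f Z)) / k`!%:R).
  move=> f; split.
    by rewrite divr_ge0 ?ler0n // addr_ge0 // sqr_ge0.
  move=> qn0 i j fij; apply/eqP; apply: contraNT qn0 => nij.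
  suff -> : \det (colsub f Z) = 0 by rewrite /q /= expr0n addr0 mul0r.
  rewrite -det_tr; apply: (determinant_alternate nij) => l.
  by rewrite !mxE fij.
move=> t.
have kC : (k`!%:R : R[i]) != 0 by rewrite pnatr_eq0 -lt0n fact_gt0.
apply: (mulIf kC); rewrite mulr_natr -mulmxA cauchy_binet.
have -> : (k`!%:R : R[i]) = (k`!%:R : R)%:C by rewrite rmorph_nat.
rewrite -rmorphM mulr_suml rmorph_sum; apply: eq_bigr => f _.
have -> : rowsub f (diag_mx (\row_j (t j)%:C) *m Z ^H) =
   diag_mx (\row_i (t (f i))%:C) *m (colsub f Z) ^H.
  by apply/matrixP => a b; rewrite mul_diag_mx [LHS]mxE mul_diag_mx !mxE.
rewrite det_mulmx det_diag det_map_mx det_tr mulrCA qE.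
under eq_bigr do rewrite mxE.
rewrite -rmorph_prod -rmorphM; congr (_%:C).
by rewrite mulrAC divfK // mulrC.
Qed.

(** By pigeonhole some value [f i0] is at least the last prefix index, so its factor is at most the
    last factor of the prefix; induction handles the other factors. *)
Lemma prod_inj_le_prefix (R : realDomainType) d k (kd : (k <= d)%N)
    (x : 'I_d -> R) (f : 'I_k -> 'I_d) :
  (forall i, 0 <= x i) -> (forall i j : 'I_d, (i <= j)%N -> x j <= x i) ->
  injective f -> \prod_i x (f i) <= \prod_i x (widen_ord kd i).
Proof.
move=> x_ge0 x_dec; elim: k kd f => [|k IHk] kd f f_inj; first by rewrite !big_ord0.
have [i0 ki0] : exists i0, (k <= f i0)%N.
  apply/existsP; apply: contraT; rewrite negb_exists => /forallP flt.
  have flt' i : (f i < k)%N by rewrite ltnNge flt.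
  have h_inj : injective (fun i => Ordinal (flt' i)).
    by move=> i j /(congr1 val) /= fij; apply/f_inj/val_inj.
  by have := leq_card _ h_inj; rewrite !card_ord ltnn.
rewrite (bigD1_ord i0) //= big_ord_recr /= mulrC.
apply: ler_pM => //; first exact: prodr_ge0.
- apply: (le_trans (IHk (ltnW kd) (fun i => f (lift i0 i)) _)).
    by move=> i j /f_inj /lift_inj.
  by rewrite le_eqVlt; apply/orP; left; apply/eqP; apply: eq_bigr => i _;
     congr x; apply: val_inj.
- exact: x_dec.
Qed.

(** After doubling and expanding, the terms compare pairwise:
    [2 * (c i * c j) <= a i * b j + a j * b i] is the arithmetic-geometric mean inequality, since
    [(c i * c j) ^+ 2] is the product of the two summands. *)
Lemma sum_cauchy_schwarz (R : realFieldType) (I : finType) (w a b c : I -> R) :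
  (forall i, 0 <= w i) -> (forall i, 0 <= a i) -> (forall i, 0 <= b i) ->
  (forall i, 0 <= c i) -> (forall i, c i ^+ 2 = a i * b i) ->
  (\sum_i w i * c i) ^+ 2 <= (\sum_i w i * a i) * (\sum_i w i * b i).
Proof.
move=> w0 a0 b0 c0 cab.
rewrite -(ler_pM2l (ltr0n R 2)) [leRHS]mulr_natl [leRHS]mulr2n.
rewrite [X in _ <= _ + X]mulrC.
rewrite expr2 !big_distrlr /= mulr_sumr -big_split /=.
apply: ler_sum => i _; rewrite mulr_sumr -big_split /=.
apply: ler_sum => j _.
have ww : 0 <= w i * w j by rewrite mulr_ge0.
have -> : 2 * (w i * c i * (w j * c j)) = w i * w j * (2 * (c i * c j)) by ring.
have -> : w i * a i * (w j * b j) + w i * b i * (w j * a j) =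
          w i * w j * (a i * b j + a j * b i) by ring.
apply: ler_wpM2l => //.
have s2 : (c i * c j) ^+ 2 = (a i * b j) * (a j * b i).
  by rewrite exprMn !cab; ring.
have u0 : 0 <= a i * b j by rewrite mulr_ge0.
have v0 : 0 <= a j * b i by rewrite mulr_ge0.
rewrite -(@ler_pXn2r _ 2) ?nnegrE ?addr_ge0 ?mulr_ge0 //.
rewrite exprMn s2 -subr_ge0.
rewrite (_ : _ - _ = (a i * b j - a j * b i) ^+ 2) ?sqr_ge0 //.
by ring.
Qed.

Lemma det_gram_log_convex (R : rcfType) k p (Z : 'M[R[i]]_(k, p)) (a b c : 'I_p -> R) :
  (forall j, 0 <= a j) -> (forall j, 0 <= b j) -> (forall j, 0 <= c j) ->
  (forall j, c j ^+ 2 = a j * b j) ->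
  \det (Z *m diag_mx (\row_j (c j)%:C) *m Z^H) ^+ 2 <=
  \det (Z *m diag_mx (\row_j (a j)%:C) *m Z^H) *
  \det (Z *m diag_mx (\row_j (b j)%:C) *m Z^H).
Proof.
move=> a0 b0 c0 cab; have [w w_ge0 wE] := det_gram_expand Z.
rewrite !wE -rmorphM -rmorphXn lecR; apply: sum_cauchy_schwarz => f.
- by case: (w_ge0 f).
- exact: prodr_ge0.
- exact: prodr_ge0.
- exact: prodr_ge0.
- by rewrite -prodrXl -big_split; apply: eq_bigr.
Qed.

Lemma mulmxH (R : rcfType) a b c (A : 'M[R[i]]_(a, b)) (B : 'M[R[i]]_(b, c)) :
  (A *m B)^H = B^H *m A^H.
Proof. by rewrite trmx_mul map_mxM. Qed.

Lemma mxHK (R : rcfType) a b (A : 'M[R[i]]_(a, b)) : A^H^H = A.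
Proof. by apply/matrixP => i j; rewrite !mxE conjcK. Qed.

(** The rows of [H *m P] are orthonormal, so unit weights in the Gram expansion show that the [w f]
    sum to 1. The determinant is thus an average of products along injections, each bounded by the
    prefix product. *)
Lemma det_compress_bounds (R : rcfType) d k (kd : (k <= d)%N)
    (H : 'M[R[i]]_(k, d)) (P : 'M[R[i]]_d) (x : 'I_d -> R) :
  H *m H^H = 1%:M -> P^H *m P = 1%:M ->
  (forall i, 0 <= x i) -> (forall i j : 'I_d, (i <= j)%N -> x j <= x i) ->
  0 <= \det (H *m (P *m diag_mx (\row_j (x j)%:C) *m P^H) *m H^H)
    <= (\prod_i x (widen_ord kd i))%:C.
Proof.
move=> HH PP x0 x_dec.
have -> : H *m (P *m diag_mx (\row_j (x j)%:C) *m P^H) *m H^H =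
    (H *m P) *m diag_mx (\row_j (x j)%:C) *m (H *m P)^H.
  by rewrite mulmxH !mulmxA.
have [w w_ge0 wE] := det_gram_expand (H *m P).
have w_sum : \sum_f w f = 1.
  apply: (@complexI R); rewrite rmorph1 -(det1 _ k) -HH.
  have := wE (fun=> 1); rewrite (_ : diag_mx _ = 1%:M); last first.
    by apply/matrixP => i j; rewrite !mxE.
  rewrite mulmx1 mulmxH mulmxA -(mulmxA H) (mulmx1C PP) mulmx1 => ->.
  by congr (_%:C); apply: eq_bigr => f _; rewrite big1_eq mulr1.
rewrite wE lecR ler0c sumr_ge0; last first.
  by move=> f _; rewrite mulr_ge0 ?prodr_ge0 //; case: (w_ge0 f).
rewrite -[leRHS]mul1r -[X in _ <= X * _]w_sum mulr_suml; apply: ler_sum => f _.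
have [wf f_inj] := w_ge0 f.
have [->|/f_inj f_inj'] := eqVneq (w f) 0; first by rewrite !mul0r.
by apply: ler_wpM2l => //; exact: prod_inj_le_prefix.
Qed.

Lemma eigenvalue_prefix_prod (R : rcfType) d p k (kd : (k <= d)%N)
    (U P Q : 'M[R[i]]_d) (V : 'M[R[i]]_(d, p))
    (m x y : 'I_d -> R) (a b c : 'I_p -> R) :
  U^H *m U = 1%:M -> P^H *m P = 1%:M -> Q^H *m Q = 1%:M ->
  V *m diag_mx (\row_j (c j)%:C) *m V^H = U *m diag_mx (\row_j (m j)%:C) *m U^H ->
  V *m diag_mx (\row_j (a j)%:C) *m V^H = P *m diag_mx (\row_j (x j)%:C) *m P^H ->
  V *m diag_mx (\row_j (b j)%:C) *m V^H = Q *m diag_mx (\row_j (y j)%:C) *m Q^H ->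
  (forall j, 0 <= a j) -> (forall j, 0 <= b j) -> (forall j, 0 <= c j) ->
  (forall j, c j ^+ 2 = a j * b j) ->
  (forall i, 0 <= x i) -> (forall i j : 'I_d, (i <= j)%N -> x j <= x i) ->
  (forall i, 0 <= y i) -> (forall i j : 'I_d, (i <= j)%N -> y j <= y i) ->
  (\prod_i m (widen_ord kd i)) ^+ 2 <=
  (\prod_i x (widen_ord kd i)) * (\prod_i y (widen_ord kd i)).
Proof.
move=> UU PP QQ UE PE QE a0 b0 c0 cab x0 xd y0 yd.
(* [H] consists of the first [k] rows of [U^H]; compressing by it leaves the diagonal matrix of the
   first [k] entries of [m]. *)
set h := widen_ord kd; pose H := rowsub h U^H.
have HU : H *m U = rowsub h 1%:M by rewrite /H mul_rowsub_mx UU.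
have HH : H *m H^H = 1%:M.
  have -> : H^H = colsub h U by apply/matrixP => i j; rewrite !mxE conjcK.
  apply/matrixP => i j; rewrite /H mul_rowsub_mx mulmx_colsub UU !mxE.
  by rewrite -val_eqE.
have detM : \det (H *m (U *m diag_mx (\row_j (m j)%:C) *m U^H) *m H^H) =
    (\prod_i m (h i))%:C.
  have -> : H *m (U *m diag_mx (\row_j (m j)%:C) *m U^H) *m H^H =
      (H *m U) *m diag_mx (\row_j (m j)%:C) *m (H *m U)^H.
    by rewrite mulmxH !mulmxA.
  rewrite HU (_ : _ *m _ = diag_mx (\row_i (m (h i))%:C)).
    by rewrite det_diag rmorph_prod; apply: eq_bigr => i _; rewrite mxE.
  apply/matrixP => i j; rewrite mxE (bigD1 (h j)) //= big1 => [|l lj].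
    rewrite mul_mx_diag !mxE eqxx conjc1 mulr1 addr0 -val_eqE /= val_eqE.
    by case: eqP => [->|_]; rewrite ?mul1r ?mul0r.
  by rewrite !mxE eq_sym (negbTE lj) conjc0 mulr0.
have gramE t : (H *m V) *m diag_mx t *m (H *m V)^H = H *m (V *m diag_mx t *m V^H) *m H^H.
  by rewrite mulmxH !mulmxA.
have /andP[x_ge x_le] := det_compress_bounds kd HH PP x0 xd.
have /andP[y_ge y_le] := det_compress_bounds kd HH QQ y0 yd.
have := det_gram_log_convex (H *m V) a0 b0 c0 cab.
rewrite gramE UE detM gramE PE gramE QE => det_le.
rewrite -lecR rmorphXn rmorphM.
exact: le_trans det_le (ler_pM x_ge y_ge x_le y_le).
Qed.

(** * Majorization *)

(* Multiplicative form of the Hardy-Littlewood-Polya induction: each transfer makes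
   one more entry of [z] agree with [m]. *)
Lemma weak_log_majorization (R : realFieldType) d (F : ('I_d -> R) -> R)
    (m z : 'I_d -> R) :
  (forall u v : 'I_d -> R, (forall i, 0 <= u i <= v i) -> F u <= F v) ->
  (forall (u : 'I_d -> R) (j l : 'I_d) c, j != l -> (forall i, 0 <= u i) -> 1 <= c -> 0 < u l ->
     c * u l <= u j ->
     F (fun i => if i == j then u j / c else if i == l then c * u l else u i)
     <= F u) ->
  (forall i, 0 <= m i) -> (forall i, 0 <= z i) ->
  (forall i j : 'I_d, (i <= j)%N -> m j <= m i) ->
  (forall k : 'I_d, \prod_(i < d | (i <= k)%N) m i <= \prod_(i < d | (i <= k)%N) z i) ->
  F m <= F z.
Proof.
move=> F_mono F_transfer m0 + m_dec.
have [n] := ubnP #|[pred i | z i != m i]|.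
elim: n z => // n IHn z; rewrite ltnS => card_le z0 mz.
have [/existsP[k1 k1P]|none] := boolP [exists k, z k < m k]; last first.
  apply: F_mono => i; rewrite m0 /= leNgt; apply: contra none => lt_i.
  by apply/existsP; exists i.
have [k zk kmin] := @arg_minnP _ k1 (fun k => z k < m k) (@nat_of_ord d) k1P.
have below (i : 'I_d) : (i < k)%N -> m i <= z i.
  by move=> ik; rewrite leNgt; apply: contraL ik => /kmin; rewrite -leqNgt.
have mk0 : 0 < m k by apply: le_lt_trans zk.
have m_gt0 (i : 'I_d) : (i <= k)%N -> 0 < m i.
  by move=> ik; apply: (lt_le_trans mk0); apply: m_dec.
have prefE (u : 'I_d -> R) : \prod_(i < d | (i <= k)%N) u i =
    u k * \prod_(i < d | (i < k)%N) u i.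
  rewrite (bigD1 k) //=; congr (_ * _); apply: eq_bigl => i.
  by rewrite ltn_neqAle andbC.
have zk0 : 0 < z k.
  rewrite lt_neqAle z0 andbT eq_sym; apply/negP => /eqP zk_0.
  have := mz k; rewrite [leRHS]prefE zk_0 mul0r leNgt.
  by rewrite prodr_gt0.
(* With no excess before [k], the earlier entries of [z] and [m] agree, and the product inequality
   at [k] would force [m k <= z k]. *)
have [j jk mj] : exists2 j : 'I_d, (j < k)%N & m j < z j.
  have [/existsP[j /andP[]]|no] := boolP [exists j : 'I_d, (j < k)%N && (m j < z j)].
    by exists j.
  have same (i : 'I_d) : (i < k)%N -> z i = m i.
    move=> ik; apply/eqP; rewrite eq_le below // andbT leNgt.
    by apply: contra no => lt_i; apply/existsP; exists i; rewrite ik.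
  have := mz k; rewrite !prefE (eq_bigr _ same) ler_pM2r ?leNgt ?zk //.
  by apply: prodr_gt0 => i /ltnW; apply: m_gt0.
have mj0 : 0 < m j by rewrite m_gt0 // ltnW.
have njk : j != k by rewrite -val_eqE neq_ltn jk.
(* The largest factor that pushes neither entry past its target; the ratio attaining the minimum
   decides which of [j], [k] now agrees with [m]. *)
pose c := Num.min (z j / m j) (m k / z k).
have c1 : 1 < c by rewrite lt_min !ltr_pdivlMr // !mul1r mj zk.
have c0 : 0 < c by rewrite (lt_trans _ c1).
have cj : m j <= z j / c.
  by rewrite ler_pdivlMr // mulrC -ler_pdivlMr // ge_min lexx.
have ck : c * z k <= m k by rewrite -ler_pdivlMr // ge_min lexx orbT.
pose z' i := if i == j then z j / c else if i == k then c * z k else z i.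
have z'0 i : 0 <= z' i.
  by rewrite /z'; case: ifP => _; [rewrite divr_ge0 // ltW|
     case: ifP => _ //; rewrite mulr_ge0 // ltW].
apply: (@le_trans _ _ (F z')); last first.
  apply: F_transfer => //; first exact: ltW.
  apply: (le_trans ck); apply: (@le_trans _ _ (m j)); last exact: ltW.
  by apply: m_dec; apply: ltnW.
apply: IHn => // [|i].
- apply: leq_trans card_le; apply: proper_card; apply/properP; split.
    apply/subsetP => i; rewrite !inE /z'.
    have [->|_] := eqVneq i j; first by rewrite (gt_eqF mj).
    by have [->|//] := eqVneq i k; rewrite (lt_eqF zk).
  have [cE|cE] := leP (z j / m j) (m k / z k).
    exists j; first by rewrite inE gt_eqF.
    rewrite inE /z' eqxx /c min_l //.
    by rewrite invf_div mulrCA divff ?mulr1 ?eqxx ?gt_eqF // (lt_trans mj0).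
  exists k; first by rewrite inE lt_eqF.
  rewrite inE /z' [k == j]eq_sym (negbTE njk) eqxx /c min_r ?ltW //.
  by rewrite divfK ?eqxx ?gt_eqF.
(* A prefix containing [k] also contains [j], so its product is unchanged. A prefix ending before
   [k] dominates that of [m] factor by factor, by the minimality of [k]. *)
- have [ki|ik] := leqP k i.
    suff -> : \prod_(l < d | (l <= i)%N) z' l = \prod_(l < d | (l <= i)%N) z l by [].
    have ji : (j <= i)%N by rewrite (leq_trans _ ki) // ltnW.
    have prodE (u : 'I_d -> R) : \prod_(l < d | (l <= i)%N) u l =
        u j * u k * \prod_(l < d | ((l <= i)%N && (l != j)) && (l != k)) u l.
      by rewrite (bigD1 j ji) (bigD1 k) /= ?ki ?(eq_sym k) ?njk // mulrA.
    rewrite !prodE; congr (_ * _).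
      rewrite /z' eqxx eq_sym (negbTE njk) eqxx.
      by rewrite mulrA divfK // gt_eqF.
    apply: eq_bigr => l /andP[/andP[_ /negbTE lj] /negbTE lk].
    by rewrite /z' lj lk.
  apply: ler_prod => l li; rewrite m0 /= /z'.
  have lk := leq_ltn_trans li ik.
  have [->//|_] := eqVneq l j; have [lE|_] := eqVneq l k; last exact: below.
  by rewrite lE ltnn in lk.
Qed.

(** * Transfer to matrices over [R[i]] *)

Definition toC (c : Defs.C) : R[i] := Complex (Cre c) (Cim c).
Definition ofC (c : R[i]) : Defs.C := mkC (complex.Re c) (complex.Im c).

Lemma toCK : cancel toC ofC. Proof. by case. Qed.
Lemma ofCK : cancel ofC toC. Proof. by case. Qed.
Lemma toCD x y : toC (Cadd x y) = toC x + toC y. Proof. by []. Qed.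
Lemma toCM x y : toC (Cmul x y) = toC x * toC y. Proof. by []. Qed.
Lemma toC_conj x : toC (Cconj x) = conjc (toC x). Proof. by []. Qed.
Lemma toC_RtoC r : toC (RtoC r) = r%:C. Proof. by []. Qed.
Lemma toC_sum k (f : 'I_k -> Defs.C) : toC (Csum f) = \sum_i toC (f i).
Proof. exact: (big_morph toC toCD). Qed.

Definition toM n (A : Mat n) : 'M[R[i]]_n := \matrix_(i, j) toC (A i j).
Definition ofM n (A : 'M[R[i]]_n) : Mat n := fun i j => ofC (A i j).

Lemma toMK n : cancel (@toM n) (@ofM n).
Proof.
move=> A; apply: functional_extensionality => i.
by apply: functional_extensionality => j; rewrite /ofM mxE toCK.
Qed.

Lemma ofMK n : cancel (@ofM n) (@toM n).
Proof. by move=> A; apply/matrixP => i j; rewrite mxE ofCK. Qed.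

Lemma toM_mul n (A B : Mat n) : toM (mmul A B) = toM A *m toM B.
Proof.
apply/matrixP => i j; rewrite !mxE toC_sum.
by apply: eq_bigr => k _; rewrite !mxE toCM.
Qed.

Lemma toM_add n (A B : Mat n) : toM (madd A B) = toM A + toM B.
Proof. by apply/matrixP => i j; rewrite !mxE toCD. Qed.

Lemma toM_scale n c (A : Mat n) : toM (mscale c A) = toC c *: toM A.
Proof. by apply/matrixP => i j; rewrite !mxE toCM. Qed.

Lemma toM_sum n m (F : 'I_m -> Mat n) : toM (msum F) = \sum_i toM (F i).
Proof.
apply/matrixP => i j; rewrite summxE !mxE toC_sum.
by apply: eq_bigr => k _; rewrite mxE.
Qed.

Lemma toM_adj n (A : Mat n) : toM (madj A) = (toM A)^H.
Proof. by apply/matrixP => i j; rewrite !mxE. Qed.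

Lemma toM_id n : toM (@mid n) = 1%:M.
Proof. by apply/matrixP => i j; rewrite !mxE /mid; case: eqP. Qed.

Lemma toM_diag n (lam : 'I_n -> R) : toM (mdiag lam) = diag_mx (\row_j (lam j)%:C).
Proof.
apply/matrixP => i j; rewrite !mxE /mdiag.
by case: eqP => [->|_] //; rewrite mulr1n.
Qed.

Lemma unitaryE n (U : Mat n) : unitary U <-> (toM U)^H *m toM U = 1%:M.
Proof.
rewrite /unitary -toM_adj -toM_mul -toM_id; split=> [-> //|].
exact: (can_inj (@toMK n)).
Qed.

Lemma hermitianE n (A : Mat n) : Defs.hermitian A <-> (toM A)^H = toM A.
Proof.
split=> [Ah|AE i j].
  by apply/matrixP => i j; rewrite !mxE -toC_conj -Ah.
apply: (can_inj toCK); rewrite toC_conj.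
by have := congr1 (fun M : 'M_n => M j i) AE; rewrite !mxE.
Qed.

Lemma spectral_decompE n (A U : Mat n) lam : spectral_decomp A U lam <->
  (toM U)^H *m toM U = 1%:M /\
  toM A = toM U *m diag_mx (\row_j (lam j)%:C) *m (toM U)^H.
Proof.
rewrite /spectral_decomp unitaryE -toM_diag -toM_adj -!toM_mul.
by split=> -[-> AE]; split=> //; [rewrite AE|apply: (can_inj (@toMK n))].
Qed.

(** * Spectral decomposition and functional calculus *)

Lemma diag_mx_realH (K : rcfType) n (lam : 'I_n -> K) :
  (diag_mx (\row_j (lam j)%:C))^H = diag_mx (\row_j (lam j)%:C).
Proof.
rewrite tr_diag_mx map_diag_mx; congr diag_mx.
by apply/matrixP => i j; rewrite !mxE; apply: conjc_real.
Qed.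

Lemma spectral_decomp_hermitian n (A U : Mat n) lam : spectral_decomp A U lam -> Defs.hermitian A.
Proof.
move=> /spectral_decompE[_ AE]; apply/hermitianE.
by rewrite AE !mulmxH mxHK mulmxA diag_mx_realH.
Qed.

Lemma hermitian_diagonalization (K : numClosedFieldType) n (M : 'M[K]_n) :
  map_mx Num.conj M^T = M ->
  exists P (l : 'rV_n), [/\ P *m map_mx Num.conj P^T = 1%:M,
    M = map_mx Num.conj P^T *m diag_mx l *m P & forall i, l 0 i \is Num.real].
Proof.
move=> Mh.
have Mherm : M \is hermsymmx.
  by apply/is_hermitianmxP; rewrite expr0 scale1r -[LHS]Mh.
have PU := spectral_unitarymx M.
exists (spectralmx M), (spectral_diag M); split; first exact/unitarymxP.
  rewrite -(invmx_unitary PU).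
  exact: (orthomx_spectralP (hermitian_normalmx Mherm)).
by move=> i; apply: (mxOverP (hermitian_spectral_diag_real Mherm)).
Qed.

Lemma hermitian_spectral_decomp n (A : Mat n) :
  Defs.hermitian A -> exists U lam, spectral_decomp A U lam.
Proof.
move=> /hermitianE /hermitian_diagonalization[P [l [PP AE l_real]]].
exists (ofM P^H), (fun i => complex.Re (l 0 i)).
apply/spectral_decompE; rewrite !ofMK mxHK; split; first exact: PP.
rewrite AE; congr (_ *m diag_mx _ *m _); apply/matrixP => i j.
by rewrite mxE ord1 RRe_real.
Qed.

(** Entrywise, a nonzero [W i j] forces [mu i = lam j], and then the values of [f] agree too. *)
Lemma diag_intertwine (K : rcfType) n (f : K -> K) (mu lam : 'I_n -> K) (W : 'M[K[i]]_n) :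
  diag_mx (\row_j (mu j)%:C) *m W = W *m diag_mx (\row_j (lam j)%:C) ->
  diag_mx (\row_j (f (mu j))%:C) *m W = W *m diag_mx (\row_j (f (lam j))%:C).
Proof.
move=> /matrixP WE; apply/matrixP => i j.
have := WE i j; rewrite !mul_diag_mx !mul_mx_diag !mxE mulrC => Wij.
have [->|W0] := eqVneq (W i j) 0; first by rewrite mulr0 mul0r.
by move: Wij => /(mulfI W0) /complexI ->; rewrite mulrC.
Qed.

(** Epsilon may pick another decomposition [V], [mu]. The matrix [V^H *m U] intertwines the two
    diagonals, hence also their images under [f], so both decompositions give the same result. *)
Lemma funcalcE n f (A U : Mat n) lam : spectral_decomp A U lam ->
  toM (funcalc f A) =
  toM U *m diag_mx (\row_j (f (lam j))%:C) *m (toM U)^H.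
Proof.
move=> AU; have [/spectral_decompE [UU AE]] := (AU, AU).
have : exists B, exists V mu, spectral_decomp A V mu /\
    B = mmul (mmul V (mdiag (fun i => f (mu i)))) (madj V).
  by eexists; exists U, lam.
move=> /(epsilon_spec (inhabits (@mzero n)))[V [mu [/spectral_decompE[VV AE']]]].
rewrite -/(funcalc f A) => ->; rewrite !toM_mul toM_adj toM_diag.
set W := (toM V)^H *m toM U.
have intertwine : diag_mx (\row_j (mu j)%:C) *m W = W *m diag_mx (\row_j (lam j)%:C).
  transitivity ((toM V)^H *m toM A *m toM U).
    by rewrite AE' !mulmxA VV mul1mx.
  by rewrite AE -!mulmxA UU mulmx1.
have f_intertwine := diag_intertwine f intertwine.
transitivity (toM V *m (diag_mx (\row_j (f (mu j))%:C) *m W) *m (toM U)^H).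
  by rewrite /W -!mulmxA (mulmx1C UU) mulmx1.
by rewrite f_intertwine /W !mulmxA (mulmx1C VV) mul1mx.
Qed.

(** * Symmetric gauge functions *)

Lemma symmetric_normU d (N : Mat d -> R) (U V : 'M[R[i]]_d) (A : Mat d) :
  symmetric_norm N -> U^H *m U = 1%:M -> V^H *m V = 1%:M ->
  N (ofM (U *m toM A *m V)) = N A.
Proof.
move=> [_ [_ [_ [_ NU]]]] UU VV.
rewrite -(NU (ofM U) (ofM V) A) ?unitaryE ?ofMK //.
by congr N; rewrite -[RHS]toMK !toM_mul !ofMK.
Qed.

Lemma gauge_comb d (N : Mat d -> R) (a b : R) (u v : 'I_d -> R) :
  symmetric_norm N -> 0 <= a -> 0 <= b ->
  N (mdiag (fun i => a * u i + b * v i)) <= a * N (mdiag u) + b * N (mdiag v).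
Proof.
move=> [_ [_ [NZ [ND _]]]] a0 b0.
have NZ' c w : 0 <= c -> N (mscale (RtoC c) (mdiag w)) = c * N (mdiag w).
  move=> c0; rewrite NZ; congr (_ * _); rewrite /Cmod /=.
  by rewrite Rmult_0_l Rplus_0_r; apply: sqrt_square; apply/RleP.
rewrite -!NZ' //; have /RleP := ND (mscale (RtoC a) (mdiag u)) (mscale (RtoC b) (mdiag v)).
congr (N _ <= _); apply: (can_inj (@toMK d)).
rewrite toM_add !toM_scale !toM_diag; apply/matrixP => i j; rewrite !mxE.
rewrite !toC_RtoC.
by case: eqP => _; rewrite ?mulr0n ?mulr0 ?addr0 // !mulr1n -!rmorphM -rmorphD.
Qed.

Lemma gauge_perm d (N : Mat d -> R) (s : {perm 'I_d}) (v : 'I_d -> R) :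
  symmetric_norm N -> N (mdiag (fun i => v (s i))) = N (mdiag v).
Proof.
move=> NS; pose P : 'M[R[i]]_d := perm_mx s.
have PH (r : {perm 'I_d}) : (perm_mx r : 'M[R[i]]_d)^H = perm_mx (r^-1)%g.
  by rewrite tr_perm_mx map_perm_mx.
rewrite -(symmetric_normU (mdiag v) NS (U := P) (V := P^H)); first last.
- by rewrite mxHK PH -perm_mxM mulgV perm_mx1.
- by rewrite PH -perm_mxM mulVg perm_mx1.
congr N; rewrite -[LHS]toMK; congr ofM; rewrite !toM_diag PH -row_permE -col_permE.
by apply/matrixP => i j; rewrite !mxE (inj_eq perm_inj).
Qed.

(** The sign change is left multiplication by a diagonal unitary with entries 1 and -1. *)
Lemma gauge_flip d (N : Mat d -> R) (j : 'I_d) (v : 'I_d -> R) :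
  symmetric_norm N ->
  N (mdiag (fun i => if i == j then - v i else v i)) = N (mdiag v).
Proof.
move=> NS; pose e i : R := if i == j then -1 else 1.
rewrite -(symmetric_normU (mdiag v) NS (U := diag_mx (\row_i (e i)%:C)) (V := 1%:M)).
- congr N; rewrite -[LHS]toMK; congr ofM; rewrite mulmx1 !toM_diag mulmx_diag.
  congr diag_mx; apply/matrixP => i l; rewrite !mxE /e.
  by case: eqP; rewrite -rmorphM ?mul1r ?mulN1r.
- apply/matrixP => i l; rewrite mul_mx_diag !mxE [l == i]eq_sym.
  case: (i == l); last by rewrite mulr0n conjc0 mul0r.
  by rewrite !mulr1n conjc_real -rmorphM /e; case: eqP; rewrite ?mulrNN mulr1.
- by rewrite mulmx1 trmx1 map_mx1.
Qed.

(* One entry at a time, [u] is a convex combination of [v] and of [v] with a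
   sign changed. *)
Lemma gauge_mono d (N : Mat d -> R) (u v : 'I_d -> R) :
  symmetric_norm N -> (forall i, 0 <= u i <= v i) -> N (mdiag u) <= N (mdiag v).
Proof.
move=> NS uv.
pose w k (i : 'I_d) := if (i < k)%N then u i else v i.
suff w_le k : N (mdiag (w k)) <= N (mdiag v).
  apply: le_trans (w_le d); rewrite le_eqVlt; apply/orP; left; apply/eqP.
  by congr (N (mdiag _)); apply: functional_extensionality => i; rewrite /w ltn_ord.
elim: k => [|k IHk]; first exact: lexx.
have [dk|kd] := leqP d k.
  suff -> : w k.+1 = w k by [].
  apply: functional_extensionality => i.
  by rewrite /w ltnS (leq_trans (ltn_ord i) dk) ltnW // (leq_trans (ltn_ord i) dk).
apply: le_trans IHk; pose j := Ordinal kd.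
have /andP[u0 uv_j] := uv j.
(* The default 0 is consistent: [v j = 0] forces [u j = 0], so [th * v j = u j] in both cases. *)
pose th := if v j == 0 then 0 else u j / v j.
have v0 : 0 <= v j by apply: le_trans uv_j.
have thE : th * v j = u j.
  rewrite /th; case: eqP => [vE|/eqP vE]; last by rewrite divfK.
  by apply/eqP; rewrite mul0r eq_le u0 -vE.
have [th0 th1] : 0 <= th /\ th <= 1.
  rewrite /th; case: eqP => [_|/eqP vE]; first by rewrite lexx ler01.
  by rewrite divr_ge0 // ler_pdivrMr ?mul1r // lt_neqAle eq_sym vE.
(* The weights sum to 1, which fixes the entries other than [j], and differ by [th], which turns
   [v j] into [th * v j]. *)
have -> : w k.+1 = fun i => (1 + th) / 2 * w k i +
    (1 - th) / 2 * (if i == j then - w k i else w k i).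
  apply: functional_extensionality => i.
  rewrite /w ltnS leq_eqVlt; case: (eqVneq i j) => [->|ij].
    by rewrite /= eqxx ltnn -thE; field.
  by rewrite -val_eqE in ij; rewrite (negbTE ij) /=; case: ifP => _; field.
apply: le_trans (gauge_comb (w k) (fun i => if i == j then - w k i else w k i) NS _ _) _.
- by rewrite divr_ge0 ?addr_ge0.
- by rewrite divr_ge0 ?subr_ge0.
rewrite (gauge_flip j (w k) NS); rewrite le_eqVlt; apply/orP; left; apply/eqP.
by field.
Qed.

(** * Geometric means *)

Lemma conjcM (K : rcfType) (x y : K[i]) : conjc (x * y) = conjc x * conjc y.
Proof. exact: rmorphM. Qed.

Lemma conjc_sum (K : rcfType) (I : finType) (f : I -> K[i]) :
  conjc (\sum_i f i) = \sum_i conjc (f i).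
Proof. exact: rmorph_sum. Qed.

Lemma toC_qform n (A : Mat n) (x : Vec n) :
  toC (qform A x) = \sum_j (\sum_i conjc (toC (x i)) * toM A i j) * toC (x j).
Proof.
rewrite toC_sum; under eq_bigr => i _ do rewrite toC_sum.
rewrite exchange_big /=; apply: eq_bigr => j _; rewrite mulr_suml.
by apply: eq_bigr => i _; rewrite !toCM mxE mulrA.
Qed.

Lemma psd_outer n (v : 'cV[R[i]]_n) : psd (ofM (v *m v^H)).
Proof.
split; first by apply/hermitianE; rewrite ofMK mulmxH mxHK.
move=> x; apply/RleP; change (0 <= complex.Re (toC (qform (ofM (v *m v^H)) x))).
set z := \sum_i conjc (toC (x i)) * v i 0.
have -> : toC (qform (ofM (v *m v^H)) x) = z * conjc z.
  rewrite toC_qform ofMK {2}/z conjc_sum mulr_sumr; apply: eq_bigr => j _.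
  rewrite conjcM conjcK [toC _ * conjc _]mulrC mulrA; congr (_ * _).
  by rewrite mulr_suml; apply: eq_bigr => i _; rewrite !mxE big_ord1 !mxE mulrA.
by have := mulcJ_ge0 z; rewrite lecE => /andP[].
Qed.

Lemma psd_gram n (A : Mat n) : psd A -> exists V : 'M[R[i]]_n, toM A = V *m V^H.
Proof.
move=> [/hermitian_spectral_decomp[U [lam /spectral_decompE[UU AE]]] A_ge0].
(* The quadratic form at column [l] of [U] equals [lam l]. *)
have lam0 l : 0 <= lam l.
  have /RleP := A_ge0 (fun i => U i l); congr (0 <= _).
  rewrite -[RHS]/(complex.Re (lam l)%:C) -[LHS]/(complex.Re (toC (qform A (U^~ l)))).
  congr complex.Re.
  have <- : ((toM U)^H *m toM A *m toM U) l l = (lam l)%:C.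
    rewrite AE !mulmxA UU mul1mx -mulmxA UU mulmx1.
    by rewrite !mxE eqxx.
  rewrite toC_qform [RHS]mxE; apply: eq_bigr => j _; rewrite !mxE; congr (_ * _).
  by apply: eq_bigr => i _; rewrite !mxE.
exists (toM U *m diag_mx (\row_j (Num.sqrt (lam j))%:C)).
rewrite AE mulmxH diag_mx_realH !mulmxA; congr (_ *m _); rewrite -mulmxA; congr (_ *m _).
rewrite mulmx_diag; congr diag_mx; apply/matrixP => i j.
by rewrite !mxE -rmorphM -expr2 sqr_sqrtr.
Qed.

Lemma hermitian_funcalc n f (A : Mat n) : Defs.hermitian A -> Defs.hermitian (funcalc f A).
Proof.
move=> /hermitian_spectral_decomp[U [lam AU]]; have [UU _] := AU.
apply: (@spectral_decomp_hermitian _ _ U (fun i => f (lam i))).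
by apply/spectral_decompE; rewrite (funcalcE f AU); split=> //; apply/unitaryE.
Qed.

Lemma gmean_sum n (A B : Mat n) : Defs.hermitian A -> Defs.hermitian B ->
  exists (c : 'I_n -> R) (Q : 'I_n -> Mat n), (forall k, psd (Q k)) /\
    forall t, toM (gmean t A B) = \sum_k (Rpower (c k) t)%:C *: toM (Q k).
Proof.
move=> Ah Bh; rewrite /gmean; set S := mpow _ A; set T := mpow _ A.
have /hermitianE Sh : Defs.hermitian S by apply: hermitian_funcalc.
have /hermitianE Th : Defs.hermitian T by apply: hermitian_funcalc.
have : Defs.hermitian (mmul (mmul T B) T).
  apply/hermitianE; rewrite !toM_mul !mulmxH Th mulmxA.
  by move/hermitianE: Bh => ->.
move=> /hermitian_spectral_decomp[W [c CW]].
(* The mean becomes [Y] times the diagonal of powers times [Y^H]; each column of [Y], free of [t],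
   contributes one rank-one term. *)
pose Y := toM S *m toM W.
exists c, (fun k => ofM (col k Y *m (col k Y)^H)); split; first by move=> k; apply: psd_outer.
move=> t; rewrite !toM_mul (funcalcE _ CW).
have -> : toM S *m (toM W *m diag_mx (\row_j (Rpower (c j) t)%:C) *m (toM W)^H) *m toM S =
    Y *m diag_mx (\row_j (Rpower (c j) t)%:C) *m Y^H.
  by rewrite /Y mulmxH Sh !mulmxA.
apply/matrixP => i j; rewrite summxE mxE; apply: eq_bigr => k _.
rewrite ofMK mul_mx_diag [RHS]mxE !mxE big_ord1 !mxE.
by rewrite mulrAC mulrC.
Qed.

Lemma positive_linear_map_sum n d (I : finType) (Phi : Mat n -> Mat d)
    (a : I -> R[i]) (Q : I -> Mat n) :
  positive_linear_map Phi ->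
  toM (Phi (ofM (\sum_i a i *: toM (Q i)))) = \sum_i a i *: toM (Phi (Q i)).
Proof.
move=> [PhiD [PhiZ _]].
pose F (M : 'M[R[i]]_n) := toM (Phi (ofM M)).
have FD M M' : F (M + M') = F M + F M'.
  rewrite /F -toM_add -PhiD; congr (toM (Phi _)).
  by apply: (can_inj (@toMK n)); rewrite toM_add !ofMK.
have FZ z M : F (z *: M) = z *: F M.
  rewrite /F -{2}[z]ofCK -toM_scale -PhiZ; congr (toM (Phi _)).
  by apply: (can_inj (@toMK n)); rewrite toM_scale !ofMK ofCK.
have F0 : F 0 = 0 by rewrite -[X in F X](scale0r 0) FZ scale0r.
rewrite -/(F _) (big_morph F FD F0); apply: eq_bigr => i _.
by rewrite FZ /F toMK.
Qed.

(** [V] places the matrices [W i] side by side; each column keeps the weight of its block. *)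
Lemma gram_sum (I : finType) d (a : I -> R) (W : I -> 'M[R[i]]_d) :
  \sum_i (a i)%:C *: (W i *m (W i)^H) =
  let V := \matrix_(l < d, j < #|{: I * 'I_d}|) W (enum_val j).1 l (enum_val j).2 in
  V *m diag_mx (\row_j (a (enum_val j).1)%:C) *m V^H.
Proof.
apply/matrixP => k l; rewrite summxE mxE.
rewrite (eq_bigr (fun i => \sum_e (a i)%:C * (W i k e * conjc (W i l e)))); last first.
  by move=> i _; rewrite mxE mxE mulr_sumr; apply: eq_bigr => e _; rewrite !mxE.
rewrite pair_bigA /= (reindex (@enum_val _ {: I * 'I_d})) /=; last first.
  exact/onW_bij/enum_val_bij.
by apply: eq_bigr => j _; rewrite mul_mx_diag !mxE mulrCA mulrA.
Qed.

Lemma phi_gmean_gram n d m (A B : 'I_m -> Mat n) (Phi : Mat n -> Mat d) :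
  (forall i, Defs.hermitian (A i)) -> (forall i, Defs.hermitian (B i)) ->
  positive_linear_map Phi ->
  exists p (V : 'M[R[i]]_(d, p)) (w : ('I_m -> R) -> 'I_p -> R),
  [/\ forall t j, 0 <= w t j,
      forall r s t, (forall i, r i + r i = s i + t i) ->
        forall j, w r j ^+ 2 = w s j * w t j
    & forall t, toM (Phi (msum (fun i => gmean (t i) (A i) (B i)))) =
        V *m diag_mx (\row_j (w t j)%:C) *m V^H].
Proof.
move=> Ah Bh PhiP.
have [c] := fin_all_exists (fun i => gmean_sum (Ah i) (Bh i)).
move=> /fin_all_exists[Q QP].
have Phi_psd ik : psd (Phi (Q ik.1 ik.2)) by case: PhiP => _ [_]; apply; case: (QP ik.1).
have [W WE] := fin_all_exists (fun ik => psd_gram (Phi_psd ik)).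
pose a (t : 'I_m -> R) (ik : 'I_m * 'I_n) := Rpower (c ik.1 ik.2) (t ik.1).
exists #|{: ('I_m * 'I_n) * 'I_d}|,
  (\matrix_(l < d, j < #|{: ('I_m * 'I_n) * 'I_d}|) W (enum_val j).1 l (enum_val j).2),
  (fun t j => a t (enum_val j).1); split.
(* [Rpower x t] unfolds to [exp (t * ln x)], positive for every base. *)
- by move=> t j; apply/RleP/Rlt_le/exp_pos.
- move=> r s t rst j; rewrite /a expr2 -!RmultE -!Rpower_plus; congr Rpower.
  exact: rst.
- move=> t; transitivity (\sum_ik (a t ik)%:C *: (W ik *m (W ik)^H)).
  + have msumE : toM (msum (fun i => gmean (t i) (A i) (B i))) =
        \sum_i \sum_k (Rpower (c i k) (t i))%:C *: toM (Q i k).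
    by rewrite toM_sum; apply: eq_bigr => i _; have [_ ->] := QP i.
  rewrite pair_bigA /= in msumE.
  rewrite -[msum _]toMK msumE.
  rewrite (positive_linear_map_sum (Phi := Phi) (fun ik => (a t ik)%:C) (fun ik => Q ik.1 ik.2)) //.
  by apply: eq_bigr => ik _; rewrite WE.
  + exact: gram_sum.
Qed.

(** * Sorted eigenvalues and the norm inequality *)

Lemma sorting_perm d (lam : 'I_d -> R) :
  exists s : {perm 'I_d}, forall i j : 'I_d, (i <= j)%N -> lam (s j) <= lam (s i).
Proof.
pose t := [tuple lam i | i < d].
pose st : seq R := sort (fun x y => y <= x) t.
have /tuple_permP[s sE] : perm_eq st t by rewrite perm_sort.
exists s => i j ij.
have srt : sorted (fun x y : R => y <= x) st.
  by apply: sort_sorted => x y; apply: le_total.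
have in_size (k : 'I_d) : nat_of_ord k \in [pred l | (l < size st)%N].
  by rewrite inE size_sort size_tuple.
have nthE (k : 'I_d) : nth (lam i) st k = lam (s k).
  by rewrite sE -tnth_nth !tnth_mktuple.
rewrite -!nthE; apply: sorted_leq_nth srt _ _ (in_size i) (in_size j) ij.
  by move=> y x z xy yz; apply: le_trans yz xy.
exact: lexx.
Qed.

Lemma hermitian_sorted_decomp n (A : Mat n) : Defs.hermitian A ->
  exists U lam, spectral_decomp A U lam /\
    forall i j : 'I_n, (i <= j)%N -> lam j <= lam i.
Proof.
move=> /hermitian_spectral_decomp[U [lam /spectral_decompE[UU AE]]].
have [s s_sorted] := sorting_perm lam.
pose P : 'M[R[i]]_n := perm_mx s^-1.
have PH : P^H = perm_mx s by rewrite tr_perm_mx map_perm_mx invgK.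
have PP : P *m P^H = 1%:M by rewrite PH -perm_mxM mulVg perm_mx1.
exists (ofM (toM U *m P)), (fun i => lam (s i)); split=> //.
apply/spectral_decompE; rewrite ofMK mulmxH; split.
  by rewrite mulmxA -(mulmxA P^H) UU mulmx1 (mulmx1C PP).
have -> : diag_mx (\row_j (lam (s j))%:C) = P^H *m diag_mx (\row_j (lam j)%:C) *m P.
  rewrite PH -row_permE /P -col_permE.
  by apply/matrixP => i j; rewrite !mxE (inj_eq perm_inj).
by rewrite !mulmxA -(mulmxA _ P) PP mulmx1 -(mulmxA _ P) PP mulmx1.
Qed.

(** In the eigenbasis, each eigenvalue is a diagonal entry of [Z *m diag_mx _ *m Z^H], a sum of
    squared moduli with weights [w j]. *)
Lemma gram_eigenvalues_ge0 d p (A U : Mat d) lam (V : 'M[R[i]]_(d, p)) (w : 'I_p -> R) :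
  spectral_decomp A U lam -> (forall j, 0 <= w j) ->
  toM A = V *m diag_mx (\row_j (w j)%:C) *m V^H -> forall i, 0 <= lam i.
Proof.
move=> /spectral_decompE[UU AE] w0 AV i.
pose Z := (toM U)^H *m V.
have : diag_mx (\row_j (lam j)%:C) = Z *m diag_mx (\row_j (w j)%:C) *m Z^H.
  transitivity ((toM U)^H *m toM A *m toM U).
    by rewrite AE !mulmxA UU mul1mx -mulmxA UU mulmx1.
  by rewrite AV /Z mulmxH mxHK !mulmxA.
move=> /matrixP/(_ i i); rewrite !mxE eqxx mulr1n => lamE.
rewrite -ler0c lamE; apply: sumr_ge0 => j _.
rewrite mul_mx_diag [X in X * _]mxE [(\row__ _) _ _]mxE [Z^H _ _]mxE [Z^T _ _]mxE.
by rewrite mulrAC mulr_ge0 ?mulcJ_ge0 ?ler0c.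
Qed.

Lemma norm_funcalc d (N : Mat d -> R) g (A U : Mat d) lam :
  symmetric_norm N -> spectral_decomp A U lam ->
  N (funcalc g A) = N (mdiag (fun i => g (lam i))).
Proof.
move=> NS AU; have [/unitaryE UU _] := AU.
rewrite -(symmetric_normU (mdiag (fun i => g (lam i))) NS (U := toM U) (V := (toM U)^H)) //.
  by rewrite toM_diag -(funcalcE g AU) toMK.
by rewrite mxHK (mulmx1C UU).
Qed.

(** By convexity the new vector lies entrywise below a convex combination of [g] along [u] and the
    same vector with entries [j] and [l] swapped; both have the same norm. *)
Lemma gauge_transfer d (N : Mat d -> R) g (u : 'I_d -> R) (j l : 'I_d) c :
  symmetric_norm N -> geom_convex g ->
  j != l -> (forall i, 0 <= u i) -> 1 <= c -> 0 < u l -> c * u l <= u j ->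
  N (mdiag (fun i => g (if i == j then u j / c else if i == l then c * u l else u i)))
  <= N (mdiag (fun i => g (u i))).
Proof.
move=> NS gc jl u0 /RleP c1 /RltP ul0 /RleP cu.
have [th [[/RleP th0 /RleP th1] [/RleP gj /RleP gl]]] := geom_convex_transfer gc ul0 c1 cu.
have g0 x : 0 <= x -> 0 <= g x by move=> /RleP x0; apply/RleP; case: gc => _ [+ _]; apply.
have c0 : 0 <= c by apply: le_trans ler01 _; apply/RleP.
pose gu i := g (u i).
apply: (@le_trans _ _ (N (mdiag (fun i => th * gu i + (1 - th) * gu (tperm j l i))))).
  apply: gauge_mono => // i; apply/andP; split.
    by apply: g0; case: ifP => _; [rewrite divr_ge0|case: ifP => _ //; rewrite mulr_ge0].
  have [->|ij] := eqVneq i j; first by rewrite tpermL -RdivE.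
  have [->|il] := eqVneq i l.
    by rewrite tpermR addrC.
  rewrite tpermD 1?eq_sym // -mulrDl addrCA subrr addr0 mul1r.
  exact: lexx.
apply: le_trans (gauge_comb gu (fun i => gu (tperm j l i)) NS th0 _) _.
  by rewrite subr_ge0.
by rewrite (gauge_perm (tperm j l) gu NS) -mulrDl addrCA subrr addr0 mul1r.
Qed.

Lemma norm_funcalc_log_convex d p (N : Mat d -> R) g (V : 'M[R[i]]_(d, p))
    (a b c : 'I_p -> R) (X Y M : Mat d) :
  symmetric_norm N -> geom_convex g -> nondecreasing_nonneg g ->
  (forall j, 0 <= a j) -> (forall j, 0 <= b j) -> (forall j, 0 <= c j) ->
  (forall j, c j ^+ 2 = a j * b j) ->
  toM X = V *m diag_mx (\row_j (a j)%:C) *m V^H ->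
  toM Y = V *m diag_mx (\row_j (b j)%:C) *m V^H ->
  toM M = V *m diag_mx (\row_j (c j)%:C) *m V^H ->
  N (funcalc g M) <= Num.sqrt (N (funcalc g X) * N (funcalc g Y)).
Proof.
move=> NS gc g_mono a0 b0 c0 cab XE YE ME.
have gram_herm (w : 'I_p -> R) (Z : Mat d) :
    toM Z = V *m diag_mx (\row_j (w j)%:C) *m V^H -> Defs.hermitian Z.
  move=> ZE; apply/hermitianE; rewrite ZE !mulmxH mxHK mulmxA.
  by rewrite diag_mx_realH.
have [P [x [XP x_dec]]] := hermitian_sorted_decomp (gram_herm _ _ XE).
have [Q [y [YQ y_dec]]] := hermitian_sorted_decomp (gram_herm _ _ YE).
have [U [m [MU m_dec]]] := hermitian_sorted_decomp (gram_herm _ _ ME).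
rewrite (norm_funcalc g NS XP) (norm_funcalc g NS YQ) (norm_funcalc g NS MU).
have x0 := gram_eigenvalues_ge0 XP a0 XE.
have y0 := gram_eigenvalues_ge0 YQ b0 YE.
have m0 := gram_eigenvalues_ge0 MU c0 ME.
have g0 s : 0 <= s -> 0 <= g s by move=> /RleP s0; apply/RleP; case: gc => _ [+ _]; apply.
have N0 A : 0 <= N A by apply/RleP; case: NS.
pose z i := Num.sqrt (x i * y i).
have le_z : N (mdiag (fun i => g (m i))) <= N (mdiag (fun i => g (z i))).
  apply: (weak_log_majorization (F := fun u => N (mdiag (fun i => g (u i))))) => //.
  - move=> u v uv; apply: gauge_mono => // i; have /andP[u0 ui] := uv i.
    by rewrite g0 //=; apply/RleP/g_mono; apply/RleP.
  - by move=> u j l e jl u0 e1 ul eu; apply: (gauge_transfer NS gc jl u0 e1 ul eu).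
  - by move=> i; apply: sqrtr_ge0.
  move=> k; have kd := ltn_ord k.
  have narrow (u : 'I_d -> R) :
      \prod_(i < d | (i <= k)%N) u i = \prod_(i < k.+1) u (widen_ord kd i).
    by rewrite (big_ord_narrow kd).
  (* Squaring removes the roots in [z] and leaves the determinantal inequality for prefix
     products. *)
  rewrite !narrow -(@ler_pXn2r _ 2) ?nnegrE ?prodr_ge0 //; last first.
    by move=> i _; apply: sqrtr_ge0.
  have [/spectral_decompE[UU UE] /spectral_decompE[PP PE]] := (MU, XP).
  have /spectral_decompE[QQ QE] := YQ.
  rewrite ME in UE; rewrite XE in PE; rewrite YE in QE.
  have -> : (\prod_i z (widen_ord kd i)) ^+ 2 =
      (\prod_i x (widen_ord kd i)) * (\prod_i y (widen_ord kd i)).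
    rewrite -big_split -prodrXl; apply: eq_bigr => i _.
    by rewrite /= sqr_sqrtr // mulr_ge0.
  exact: (eigenvalue_prefix_prod kd UU PP QQ UE PE QE a0 b0 c0 cab x0 x_dec y0 y_dec).
apply: le_trans le_z _; rewrite -RsqrtE ?mulr_ge0 //.
apply/RleP; apply: le_sqrt_of_scaled_means; try exact/RleP.
move=> e /RltP e0; apply/RleP.
have two : IZR 2 = 2 by [].
have e2 : 0 <= e / 2 by rewrite divr_ge0 // ltW.
have ie2 : 0 <= e^-1 / 2 by rewrite divr_ge0 // invr_ge0 ltW.
rewrite (_ : Rdiv _ _ = e / 2 * N (mdiag (fun i => g (x i))) +
   e^-1 / 2 * N (mdiag (fun i => g (y i)))); last first.
  by rewrite RdivE RplusE !RmultE RinvE two; field; rewrite gt_eqF.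
apply: le_trans (gauge_comb (fun i => g (x i)) (fun i => g (y i)) NS e2 ie2).
apply: gauge_mono => // i; rewrite g0 ?sqrtr_ge0 //=.
have /RleP := geom_convex_sqrt gc g_mono (elimT (@RleP _ _) (x0 i)) (elimT (@RleP _ _) (y0 i)).
rewrite RsqrtE ?mulr_ge0 // => /le_trans; apply.
have gx := g0 _ (x0 i); have gy := g0 _ (y0 i).
have egx : 0 <= e * g (x i) by rewrite mulr_ge0 // ltW.
have egy : 0 <= e^-1 * g (y i) by rewrite mulr_ge0 // invr_ge0 ltW.
(* The factors [e] and [e^-1] cancel under the root, so the mean inequality bounds [g (z i)] by the
   [e]-weighted mean of [g (x i)] and [g (y i)]. *)
have /RleP := sqrt_mul_le_mean (elimT (@RleP _ _) egx) (elimT (@RleP _ _) egy).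
rewrite RmultE (_ : e * _ * _ = g (x i) * g (y i)); last by field; rewrite gt_eqF.
move=> /le_trans; apply; rewrite RdivE RplusE two le_eqVlt; apply/orP; left; apply/eqP.
by field; rewrite gt_eqF.
Qed.

Close Scope complex_scope.
Close Scope ring_scope.
Open Scope R_scope.

Theorem theorem2p1 (n d m : nat) (A B : 'I_m -> Mat n)
  (Phi : Mat n -> Mat d) (N : Mat d -> R) (g : R -> R) :
  (forall i, pd (A i)) -> (forall i, pd (B i)) ->
  positive_linear_map Phi ->
  symmetric_norm N ->
  geom_convex g -> nondecreasing_nonneg g ->
  jointly_log_convex
    (fun t : 'I_m -> R => N (funcalc g (Phi (msum (fun i => gmean (t i) (A i) (B i)))))).
Proof.
move=> Apd Bpd PhiP NS gc g_mono; split; first by move=> x; case: NS.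
move=> s t.
have [p [V [w [w0 w_mid wE]]]] :=
  phi_gmean_gram (fun i => proj1 (Apd i)) (fun i => proj1 (Bpd i)) PhiP.
have mid i : Rplus ((s i + t i) / 2) ((s i + t i) / 2) = s i + t i.
  by symmetry; apply: double_var.
have /RleP := norm_funcalc_log_convex NS gc g_mono (w0 s) (w0 t) (w0 _) (w_mid _ _ _ mid)
  (wE s) (wE t) (wE _).
by rewrite -RsqrtE ?mulr_ge0 //; apply/RleP; case: NS.
Qed.
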